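(* Let $\mathcal{T}^d=(\mathcal{N},\mathcal{E},d)$ be any tree diagram with $n$ nodes and let $f(x_1,x_2,\ldots,x_n)$ be a first-order differentiable function on $\mathbb{R}^n$. Then $$u(t,x_1,\ldots,x_n)=f(x_1+\eta_1(t),\,x_2+\eta_2(t),\,\ldots,\,x_n+\eta_n(t))$$ is the solution of the equation $$u_t=\Big(\partial_{x_1}+\sum_{(\iota_i,\iota_j)\in\mathcal{E}}x_i^{d[(\iota_i,\iota_j)]}\partial_{x_j}\Big)(u)$$ subject to the initial condition $u(0,x_1,\ldots,x_n)=f(x_1,\ldots,x_n)$. Here $\eta_1(t)=t$ and, for $2\le i\le n$ with clan $\mathcal{C}_i=\{\iota_{i_1},\iota_{i_2},\ldots,\iota_{i_r}\}$ ($i_1=1$, $i_r=i$), $$\eta_i(t)=\int_0^t\Big(x_{i_{r-1}}+\int_0^{y_{i_{r-1}}}\Big(x_{i_{r-2}}+\cdots+\int_0^{y_{i_2}}(x_1+y_1)^{d[(\iota_{i_1},\iota_{i_2})]}dy_1\cdots\Big)^{d[(\iota_{i_{r-2}},\iota_{i_{r-1}})]}dy_{i_{r-2}}\Big)^{d[(\iota_{i_{r-1}},\iota_{i_r})]}dy_{i_{r-1}}.$$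
   Context: A tree $\mathcal{T}=(\mathcal{N},\mathcal{E})$ consists of a finite set of nodes $\mathcal{N}=\{\iota_1,\ldots,\iota_n\}$ and a set of edges $\mathcal{E}\subset\{(\iota_i,\iota_j)\mid 1\le i<j\le n\}$ such that for each node $\iota_i$ there is a unique sequence $\mathcal{C}_i=\{\iota_{i_1},\ldots,\iota_{i_r}\}$ of nodes with $1=i_1<i_2<\cdots<i_r=i$ and $(\iota_{i_s},\iota_{i_{s+1}})\in\mathcal{E}$ for $1\le s\le r-1$; $\mathcal{C}_i$ is called the clan of $\iota_i$. A tree diagram $\mathcal{T}^d=(\mathcal{N},\mathcal{E},d)$ is a tree with a map $d:\mathcal{E}\to\{1,2,3,\ldots\}$. Here $t,x_1,\ldots,x_n$ are real variables and $u$ is an unknown differentiable function of $(t,x_1,\ldots,x_n)$. The nested integral formula means: $\eta_i$ depends on $t$ and on $x_{i_1},\ldots,x_{i_{r-1}}$, and if $\iota_p=\iota_{i_{r-1}}$ is the parent of $\iota_i$, then $\eta_i(t)=\int_0^t(x_p+\eta_p(y))^{d[(\iota_p,\iota_i)]}dy$. *)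

(* Defs.v *)
From HB Require Import structures.
From mathcomp Require Import all_boot all_order all_algebra.
From mathcomp Require Import all_classical all_reals all_analysis.
Set Implicit Arguments.
Unset Strict Implicit.
Unset Printing Implicit Defensive.
Import Order.TTheory GRing.Theory Num.Theory.
Import numFieldNormedType.Exports.
Local Open Scope classical_set_scope.
Local Open Scope ring_scope.

(* A tree has at least one node (the root), so its node set is 'I_n.+1;
   the ordinal i stands for the node iota_(i+1). *)

Definition is_clan (n : nat) (E : {set 'I_n.+1 * 'I_n.+1}) (i : 'I_n.+1)
    (c : seq 'I_n.+1) : bool :=
  [&& ohead c == Some ord0, last ord0 c == i,
      sorted (fun p q : 'I_n.+1 => (p < q)%N) c
    & sorted (fun p q => (p, q) \in E) c].

Record tree (n : nat) := Tree {
  edges : {set 'I_n.+1 * 'I_n.+1};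
  edges_lt : forall e, e \in edges -> (e.1 < e.2)%N;
  clan_unique : forall i, exists! c, is_clan edges i c
}.

(* Only the values of weight on edges are meaningful. *)
Record tree_diagram (n : nat) := TreeDiagram {
  diagram_tree :> tree n;
  weight : 'I_n.+1 * 'I_n.+1 -> nat;
  weight_gt0 : forall e, e \in edges diagram_tree -> (0 < weight e)%N
}.

Lemma clan_exists (n : nat) (T : tree n) (i : 'I_n.+1) :
  exists c, is_clan (edges T) i c.
Proof. by have [c [cP _]] := clan_unique T i; exists c. Qed.

Definition clan (n : nat) (T : tree n) (i : 'I_n.+1) : seq 'I_n.+1 :=
  xchoose (clan_exists T i).

(* The integral from a to b, with the usual sign convention when b < a. *)
Definition oint (R : realType) (a b : R) (g : R -> R) : R :=
  if a <= b then \int[lebesgue_measure]_(y in `[a, b]) g y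
  else - \int[lebesgue_measure]_(y in `[b, a]) g y.

(* The clan is read from the node down to the root, so that the outermost
   integral comes first: on [:: i_r; i_(r-1); ...; i_1] the value at t is the
   integral over [0, t] of (x_(i_(r-1)) + ...)^d(i_(r-1), i_r). *)
Fixpoint nested_integral (R : realType) (n : nat)
    (d : 'I_n.+1 * 'I_n.+1 -> nat) (x : 'rV[R]_n.+1) (c : seq 'I_n.+1)
    (t : R) : R :=
  match c with
  | j :: ((i :: _) as c') =>
      oint 0 t (fun y => (x 0 i + nested_integral d x c' y) ^+ d (i, j))
  | _ => t
  end.

Definition eta_fun (R : realType) (n : nat) (T : tree_diagram n)
    (x : 'rV[R]_n.+1) (i : 'I_n.+1) (t : R) : R :=
  nested_integral (weight T) x (rev (clan T i)) t.

Definition partial (R : realType) (n : nat) (i : 'I_n.+1)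
    (g : 'rV[R]_n.+1 -> R) (x : 'rV[R]_n.+1) : R :=
  'D_(delta_mx 0 i) g x.

Definition is_solution (R : realType) (n : nat) (T : tree_diagram n)
    (f : 'rV[R]_n.+1 -> R) (u : R -> 'rV[R]_n.+1 -> R) : Prop :=
  [/\ forall p : R * 'rV[R]_n.+1,
        differentiable (fun q : R * 'rV[R]_n.+1 => u q.1 q.2) p,
      forall (t : R) (x : 'rV[R]_n.+1),
        derive1 (u ^~ x) t =
        partial ord0 (u t) x
        + \sum_(e in edges T) x 0 e.1 ^+ weight T e * partial e.2 (u t) x
    & forall x : 'rV[R]_n.+1, u 0 x = f x].

(* Main.v *)
Require Import Defs.
From HB Require Import structures.
From mathcomp Require Import all_boot all_order all_algebra.
From mathcomp Require Import all_classical all_reals all_analysis.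
Set Implicit Arguments.
Unset Strict Implicit.
Unset Printing Implicit Defensive.
Import Order.TTheory GRing.Theory Num.Theory.
Import numFieldNormedType.Exports.
Local Open Scope classical_set_scope.
Local Open Scope ring_scope.

(** The right-hand side of the equation is the derivative of [u t] along the
    vector field [velocity T], whose component at the root is 1 and whose
    component at a node [j] with parent [p] is [x_p ^ d(p, j)]. The point
    [x + eta(t)] is the position at time [t] of the integral curve of this
    field that starts at [x]; the theorem is the method of characteristics.

    The clan of [j] is the clan of its parent followed by [j], so the nested
    integrals defining [eta_j] unwind one level at a time. Every integrand is a
    polynomial in time, hence each [x_j + eta_j] is the evaluation of a
    polynomial [flow_poly T x j], and integration becomes the formal operation
    [antideriv]. The equations of motion are then the polynomial identity
    [deriv_flow_poly], which holds at all nodes at once because a node other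
    than the root has exactly one incoming edge.

    Existence. A polynomial is determined by its derivative and its value at 0,
    so induction along the edges gives the semigroup law [flowD], from which
    [u s x = u t (flow T (s - t) x)]. Differentiating in [s] at [s = t] by the
    chain rule gives the equation. This needs [u] to be differentiable jointly
    in [(t, x)]: the coefficients of [flow_poly T x j] are differentiable in [x]
    and its degree is bounded uniformly in [x], since both properties survive
    sums, products and [antideriv].

    Uniqueness. If [v] is a solution, [s |-> v (t - s) (flow T s x)] has zero
    derivative ([constant_along_flow]); comparing [s = 0] with [s = t] gives
    [v t x = f (flow T t x)]. *)

(** * Antiderivatives of polynomials *)
(** The constant coefficient vanishes because division by [0%:R] yields 0. *)
Definition antideriv (R : realType) (p : {poly R}) : {poly R} :=
  \poly_(k < (size p).+1) (p`_k.-1 / k%:R).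

Lemma coef_antideriv (R : realType) (p : {poly R}) k :
  (antideriv p)`_k = p`_k.-1 / k%:R.
Proof.
rewrite coef_poly; case: ltnP => // le_pk.
by rewrite nth_default ?mul0r //; case: k le_pk.
Qed.

Lemma deriv_antideriv (R : realType) (p : {poly R}) : (antideriv p)^`() = p.
Proof.
apply/polyP => k; rewrite coef_deriv coef_antideriv -[LHS]mulr_natr.
by rewrite divfK // pnatr_eq0.
Qed.

Lemma antideriv_at0 (R : realType) (p : {poly R}) : (antideriv p).[0] = 0.
Proof. by rewrite horner_coef0 coef_antideriv invr0 mulr0. Qed.

Lemma deriv_horner0_inj (R : realType) (p q : {poly R}) :
  p^`() = q^`() -> p.[0] = q.[0] -> p = q.
Proof.
move=> eqD eq0; apply/polyP => -[|k]; first by rewrite -!horner_coef0.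
have /polyP/(_ k) := eqD; rewrite !coef_deriv => /eqP.
by rewrite eqrMn2r // => /eqP.
Qed.

(** The two branches of [oint] agree with a single formula, so the nested
    integrals need no case distinction on the sign of time. *)
Lemma oint_horner (R : realType) (p : {poly R}) (t : R) :
  oint 0 t (horner p) = (antideriv p).[t].
Proof.
have FTC (a b : R) : a < b -> \int[lebesgue_measure]_(y in `[a, b]) p.[y] =
    (antideriv p).[b] - (antideriv p).[a].
  move=> ab; rewrite /Rintegral.
  rewrite (@continuous_FTC2 _ _ (horner (antideriv p))) //.
  - by apply: continuous_subspaceT => y; exact: continuous_horner.
  - split=> [y _| |]; first exact: derivable_horner.
    + by apply: cvg_at_right_filter; exact: continuous_horner.
    + by apply: cvg_at_left_filter; exact: continuous_horner.
  - by move=> y _; rewrite -derivE deriv_antideriv.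
rewrite /oint; case: ltgtP => [t0|t0|<-]; last first.
- by rewrite set_itv1 Rintegral_set1 antideriv_at0.
- by rewrite FTC // antideriv_at0 add0r opprK.
- by rewrite FTC // antideriv_at0 subr0.
Qed.

(** [nested_integral] with integration replaced by formal antidifferentiation;
    its time variable becomes the indeterminate. *)
Fixpoint nested_poly (R : realType) (n : nat)
    (d : 'I_n.+1 * 'I_n.+1 -> nat) (x : 'rV[R]_n.+1) (c : seq 'I_n.+1) :
    {poly R} :=
  match c with
  | j :: ((i :: _) as c') =>
      antideriv (((x 0 i)%:P + nested_poly d x c') ^+ d (i, j))
  | _ => 'X
  end.

Lemma nested_integralE (R : realType) (n : nat) d (x : 'rV[R]_n.+1) c :
  nested_integral d x c = horner (nested_poly d x c).
Proof.
elim: c => [|j [|i c] IH]; [by apply/funext => t; rewrite /= hornerX..|].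
apply/funext => t.
transitivity
  (oint 0 t (fun y => (x 0 i + nested_integral d x (i :: c) y) ^+ d (i, j))).
  by [].
rewrite IH [nested_poly _ _ (j :: _)]/= -oint_horner.
by congr oint; apply/funext => y; rewrite horner_exp !hornerE.
Qed.

(** * Clans *)

Lemma clanP (n : nat) (T : tree n) i : is_clan (edges T) i (clan T i).
Proof. exact: xchooseP. Qed.

Lemma is_clan_uniq (n : nat) (T : tree n) i c :
  is_clan (edges T) i c -> clan T i = c.
Proof.
move=> cP; have [c0 [_ c0u]] := clan_unique T i.
by rewrite -(c0u _ (clanP T i)) -(c0u _ cP).
Qed.

Lemma clan_root (n : nat) (T : tree n) : clan T ord0 = [:: ord0].
Proof. by apply: is_clan_uniq; rewrite /is_clan !eqxx. Qed.

Lemma clan_edge (n : nat) (T : tree n) p j :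
  (p, j) \in edges T -> clan T j = rcons (clan T p) j.
Proof.
move=> pjE; apply: is_clan_uniq; have := clanP T p.
have /= ltpj := edges_lt pjE.
case: (clan T p) => [|a c]; first by rewrite /is_clan.
rewrite /is_clan /= !rcons_path last_rcons eqxx => /and4P[-> /eqP -> -> ->].
by rewrite pjE ltpj.
Qed.

(** The parent is the last but one element of the clan. *)
Lemma parent_exists (n : nat) (T : tree n) (j : 'I_n.+1) :
  j != ord0 -> exists p, (p, j) \in edges T.
Proof.
move=> j0; have := clanP T j; case: (clan T j) => [|a c].
  by rewrite /is_clan.
case/lastP: c => [|c b] /and4P[/eqP[->] /= /eqP lj _].
  by move: j0; rewrite -lj eqxx.
rewrite rcons_path last_rcons in lj *; rewrite lj => /andP[_ E].
by exists (last ord0 c).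
Qed.

(** By [clan_edge], removing [j] from its clan gives the clan of any parent of
    [j], and a clan ends at its own node. *)
Lemma parent_uniq (n : nat) (T : tree n) (p q j : 'I_n.+1) :
  (p, j) \in edges T -> (q, j) \in edges T -> p = q.
Proof.
move=> /clan_edge pj /clan_edge; rewrite pj => /rcons_inj[eqpq].
have /and4P[_ /eqP <- _ _] := clanP T p.
by have /and4P[_ /eqP <- _ _] := clanP T q; rewrite eqpq.
Qed.

Lemma no_edge_to_root (n : nat) (T : tree n) e :
  e \in edges T -> e.2 != ord0.
Proof. by move=> /edges_lt; case: eqP => // ->. Qed.

(** * The flow *)
Definition flow_poly (R : realType) (n : nat) (T : tree_diagram n)
    (x : 'rV[R]_n.+1) (j : 'I_n.+1) : {poly R} :=
  (x 0 j)%:P + nested_poly (weight T) x (rev (clan T j)).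

Lemma flow_poly_at0 (R : realType) (n : nat) (T : tree_diagram n)
    (x : 'rV[R]_n.+1) j : (flow_poly T x j).[0] = x 0 j.
Proof.
rewrite !hornerE; case: (rev _) => [|a [|b c]] /=; rewrite ?hornerX ?addr0 //.
by rewrite antideriv_at0 addr0.
Qed.

(** The sum has exactly one term, that of the edge from the parent, unless [j]
    is the root, when it is empty. Writing it as a sum over edges treats the
    root and the other nodes alike and matches the sum in the equation. *)
Lemma deriv_flow_poly (R : realType) (n : nat) (T : tree_diagram n)
    (x : 'rV[R]_n.+1) j :
  (flow_poly T x j)^`() = (j == ord0)%:R +
    \sum_(e in edges T | e.2 == j) flow_poly T x e.1 ^+ weight T e.
Proof.
rewrite {1}/flow_poly derivD derivC add0r.
have [->|j0] := eqVneq j ord0.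
  rewrite clan_root /= derivX big_pred0 ?addr0 // => e.
  by apply/negP => /andP[/no_edge_to_root/negPf ->].
have [p pj] := parent_exists T j0.
rewrite add0r (big_pred1 (p, j)) /=; last first.
  move=> [q k] /=; rewrite xpair_eqE; have [-> /=|_] := eqVneq k j.
    rewrite !andbT; apply/idP/eqP => [qj|-> //]; exact: parent_uniq qj pj.
  by rewrite !andbF.
rewrite (clan_edge pj) rev_rcons /flow_poly.
have : rev (clan T p) = p :: behead (rev (clan T p)).
  have /and4P[] := clanP T p; case/lastP: (clan T p) => [|c q] // _.
  by rewrite last_rcons rev_rcons => /eqP ->.
by move=> ->; rewrite /= deriv_antideriv.
Qed.

Definition flow (R : realType) (n : nat) (T : tree_diagram n)
    (t : R) (x : 'rV[R]_n.+1) : 'rV[R]_n.+1 :=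
  \row_j (flow_poly T x j).[t].

Lemma flow_eta (R : realType) (n : nat) (T : tree_diagram n)
    (t : R) (x : 'rV[R]_n.+1) :
  flow T t x = \row_j (x 0 j + eta_fun T x j t).
Proof.
by apply/rowP => j; rewrite !mxE /eta_fun nested_integralE !hornerE.
Qed.

Lemma flow0 (R : realType) (n : nat) (T : tree_diagram n)
    (x : 'rV[R]_n.+1) : flow T 0 x = x.
Proof. by apply/rowP => j; rewrite mxE flow_poly_at0. Qed.

(** Edges increase the index, so a property may be assumed at the parent. *)
Lemma node_ind (n : nat) (T : tree n) (P : 'I_n.+1 -> Prop) :
  (forall j, (forall e, e \in edges T -> e.2 = j -> P e.1) -> P j) ->
  forall j, P j.
Proof.
move=> step j; have [m] := ubnP (j : nat); elim: m j => // m IH j jm.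
by apply: step => e /edges_lt lt_e e2; apply: IH; rewrite -e2 in jm;
  exact: leq_trans lt_e jm.
Qed.

(** Both sides have the same value at time 0, and by induction the same
    derivative, since the vector field does not depend on time. *)
Lemma flow_polyD (R : realType) (n : nat) (T : tree_diagram n)
    (h : R) (x : 'rV[R]_n.+1) j :
  flow_poly T x j \Po ('X + h%:P) = flow_poly T (flow T h x) j.
Proof.
elim/(@node_ind _ T): j => j IH.
apply: deriv_horner0_inj; last first.
  by rewrite flow_poly_at0 mxE horner_comp !hornerE.
rewrite deriv_comp !deriv_flow_poly derivD derivX derivC addr0 mulr1.
rewrite rmorphD rmorph_nat rmorph_sum /=; congr (_ + _).
by apply: eq_bigr => e /andP[eE /eqP ej]; rewrite rmorphXn /= IH.
Qed.

Lemma flowD (R : realType) (n : nat) (T : tree_diagram n)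
    (t h : R) (x : 'rV[R]_n.+1) :
  flow T (t + h) x = flow T t (flow T h x).
Proof.
by apply/rowP => j; rewrite !mxE -flow_polyD horner_comp !hornerE.
Qed.

Definition velocity (R : realType) (n : nat) (T : tree_diagram n)
    (x : 'rV[R]_n.+1) : 'rV[R]_n.+1 :=
  delta_mx 0 ord0 +
  \sum_(e in edges T) x 0 e.1 ^+ weight T e *: delta_mx 0 e.2.

(** [flow T ^~ x] is the integral curve of [velocity T] through [x]. *)
Lemma is_derive_flow (R : realType) (n : nat) (T : tree_diagram n)
    (x : 'rV[R]_n.+1) (s : R) :
  is_derive s 1 (flow T ^~ x) (velocity T (flow T s x)).
Proof.
have fE j : (fun t => flow T t x 0 j) = horner (flow_poly T x j).
  by apply/funext => t; rewrite mxE.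
have dflow : derivable (flow T ^~ x) s 1.
  by apply/derivable_mxP => i j; rewrite ord1 fE; exact: derivable_horner.
apply: DeriveDef => //; rewrite derive_mx //; apply/rowP => j.
rewrite !mxE fE derive_val deriv_flow_poly hornerD horner_sum summxE.
congr (_ + _).
  by rewrite eqxx /= ; case: eqVneq; rewrite hornerE.
rewrite [LHS]big_mkcondr /=; apply: eq_bigr => e eE.
rewrite !mxE eqxx /= horner_exp eq_sym.
by case: eqVneq; rewrite ?mulr1 ?mulr0.
Qed.

Lemma diff_velocity (R : realType) (n : nat) (T : tree_diagram n)
    (g : 'rV[R]_n.+1 -> R) (x : 'rV[R]_n.+1) :
  differentiable g x ->
  'd g x (velocity T x) = partial ord0 g x
    + \sum_(e in edges T) x 0 e.1 ^+ weight T e * partial e.2 g x.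
Proof.
move=> gx; rewrite /velocity linearD linear_sum /= /partial deriveE //.
by congr (_ + _); apply: eq_bigr => e _; rewrite linearZ /= deriveE.
Qed.

(** * Joint differentiability *)

Lemma differentiable_sumr (R : realType) (V W : normedModType R) (I : Type)
    (r : seq I) (P : pred I) (f : I -> V -> W) x :
  (forall i, P i -> differentiable (f i) x) ->
  differentiable (fun y => \sum_(i <- r | P i) f i y) x.
Proof.
move=> df.
rewrite (_ : (fun y => _) = \sum_(i <- r | P i) f i); last first.
  by apply/funext => y; rewrite fct_sumE.
apply: (big_ind (fun g : V -> W => differentiable g x)) => //.
by move=> g h dg dh; exact: differentiableD.
Qed.

Lemma differentiable_fst (R : realType) (V W : normedModType R) (z : V * W) :
  differentiable (@fst V W) z.
Proof.
by apply: (@linear_differentiable _ _ _ fst) => w; exact: cvg_fst.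
Qed.

Lemma differentiable_snd (R : realType) (V W : normedModType R) (z : V * W) :
  differentiable (@snd V W) z.
Proof.
by apply: (@linear_differentiable _ _ _ snd) => w; exact: cvg_snd.
Qed.

(** The degree bound lets the value of [p x] at a time be written as a sum with
    the same number of terms for all [x], which is then differentiable in time
    and parameter jointly. *)
Definition diff_poly_family (R : realType) (V : normedModType R)
    (p : V -> {poly R}) : Prop :=
  (exists N, forall x, (size (p x) <= N)%N) /\
  forall k x, differentiable (fun y => (p y)`_k) x.

Section DiffPolyFamily.
Variables (R : realType) (V : normedModType R).
Implicit Types p q : V -> {poly R}.

Lemma diff_poly_family_const (c : {poly R}) : diff_poly_family (fun _ : V => c).
Proof.
by split=> [|k x]; [exists (size c) => _ | exact: differentiable_cst].
Qed.

Lemma diff_poly_familyC (a : V -> R) :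
  (forall x, differentiable a x) -> diff_poly_family (fun x => (a x)%:P).
Proof.
move=> da; split=> [|[|k] x]; first by exists 1 => x; exact: size_polyC_leq1.
  by under eq_fun do rewrite coefC /=.
by under eq_fun do rewrite coefC /=; exact: differentiable_cst.
Qed.

Lemma diff_poly_familyD p q : diff_poly_family p -> diff_poly_family q ->
  diff_poly_family (fun x => p x + q x).
Proof.
move=> [[M pM] dp] [[N qN] dq]; split=> [|k x].
  exists (maxn M N) => x; apply: leq_trans (size_polyD _ _) _.
  by rewrite geq_max !leq_max pM qN orbT.
by under eq_fun do rewrite coefD; exact: differentiableD.
Qed.

Lemma diff_poly_familyM p q : diff_poly_family p -> diff_poly_family q ->
  diff_poly_family (fun x => p x * q x).
Proof.
move=> [[M pM] dp] [[N qN] dq]; split=> [|k x].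
  exists (M + N)%N => x; apply: leq_trans (size_polyMleq _ _) _.
  by apply: leq_trans (leq_pred _) _; exact: leq_add.
under eq_fun do rewrite coefM.
by apply: differentiable_sumr => i _; exact: differentiableM.
Qed.

Lemma diff_poly_familyX p m : diff_poly_family p ->
  diff_poly_family (fun x => p x ^+ m).
Proof.
move=> dp; elim: m => [|m IH]; first exact: diff_poly_family_const.
by under eq_fun do rewrite exprS; exact: diff_poly_familyM.
Qed.

Lemma diff_poly_family_sum (I : Type) (r : seq I) (P : pred I)
    (p : I -> V -> {poly R}) :
  (forall i, P i -> diff_poly_family (p i)) ->
  diff_poly_family (fun x => \sum_(i <- r | P i) p i x).
Proof.
move=> dp; rewrite (_ : (fun x => _) = \sum_(i <- r | P i) p i); last first.
  by apply/funext => x; rewrite fct_sumE.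
apply: (big_ind (@diff_poly_family R V)) => //.
  exact: (diff_poly_family_const 0).
by move=> f g df dg; exact: diff_poly_familyD.
Qed.

Lemma diff_poly_family_antideriv p : diff_poly_family p ->
  diff_poly_family (fun x => antideriv (p x)).
Proof.
move=> [[N pN] dp]; split=> [|k x].
  by exists N.+1 => x; apply: leq_trans (size_poly _ _) _; rewrite ltnS.
under eq_fun do rewrite coef_antideriv.
by apply: differentiableM => //; exact: differentiable_cst.
Qed.

Lemma differentiable_horner_family p (z : R * V) : diff_poly_family p ->
  differentiable (fun w : R * V => (p w.2).[w.1]) z.
Proof.
move=> [[N pN] dp].
under eq_fun do rewrite (horner_coef_wide _ (pN _)).
apply: differentiable_sumr => k _; apply: differentiableM.
  exact: (@differentiable_comp _ _ _ _ snd (fun y => (p y)`_k)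
    _ (differentiable_snd z)).
apply: (@differentiable_comp _ _ _ _ fst (fun s : R => s ^+ k) _
  (differentiable_fst z)).
exact/derivable1_diffP/exprn_derivable.
Qed.

End DiffPolyFamily.

(** Integrating [deriv_flow_poly] expresses the polynomial at a node through
    those at its parents, which allows induction along the edges. *)
Lemma diff_poly_family_flow (R : realType) (n : nat) (T : tree_diagram n) j :
  diff_poly_family (fun x : 'rV[R]_n.+1 => flow_poly T x j).
Proof.
elim/(@node_ind _ T): j => j IH.
have E (x : 'rV[R]_n.+1) : flow_poly T x j = (x 0 j)%:P +
    antideriv ((j == ord0)%:R +
      \sum_(e in edges T | e.2 == j) flow_poly T x e.1 ^+ weight T e).
  apply: deriv_horner0_inj.
    by rewrite derivD derivC add0r deriv_antideriv deriv_flow_poly.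
  by rewrite flow_poly_at0 !hornerE antideriv_at0 addr0.
under eq_fun do rewrite E.
apply: diff_poly_familyD.
  by apply: diff_poly_familyC => x; exact: differentiable_coord.
apply: diff_poly_family_antideriv; apply: diff_poly_familyD.
  exact: diff_poly_family_const.
apply: diff_poly_family_sum => e /andP[eE /eqP ej].
by apply: diff_poly_familyX; exact: IH.
Qed.

Lemma differentiable_flow (R : realType) (n : nat) (T : tree_diagram n)
    (z : R * 'rV[R]_n.+1) :
  differentiable (fun w : R * 'rV[R]_n.+1 => flow T w.1 w.2) z.
Proof.
under eq_fun do rewrite [flow _ _ _]row_sum_delta.
apply: differentiable_sumr => j _; apply: differentiableZl.
under eq_fun do rewrite mxE.
apply: (@differentiable_horner_family _ _ (fun x => flow_poly T x j)).
exact: diff_poly_family_flow.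
Qed.

(** * Characteristics *)

Lemma is_derive_diff_comp (R : realType) (V W : normedModType R)
    (g : V -> W) (c : R -> V) (s : R) (w : V) :
  differentiable g (c s) -> is_derive s 1 c w ->
  is_derive s 1 (g \o c) ('d g (c s) w).
Proof.
move=> dg [dc <-].
have dc' : differentiable c s by exact/derivable1_diffP.
have dgc : differentiable (g \o c) s by exact: differentiable_comp.
apply: DeriveDef; first exact/derivable1_diffP.
by rewrite !deriveE // diff_comp.
Qed.

Section Slices.
Variables (R : realType) (V : normedModType R) (v : R -> V -> R).
Variables (t : R) (x : V).
Hypothesis dv : differentiable (fun q : R * V => v q.1 q.2) (t, x).

Lemma differentiable_slice : differentiable (v t) x.
Proof.
by apply: (@differentiable_comp _ _ _ _ (fun y => (t, y))
  (fun q => v q.1 q.2)).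
Qed.

Lemma diff_slice w :
  'd (v t) x w = 'd (fun q : R * V => v q.1 q.2) (t, x) (0, w).
Proof.
have df : is_diff x (fun y => (t, y)) (fun y => (0, y)) by exact: is_diff_eq.
rewrite (_ : v t = (fun q => v q.1 q.2) \o (fun y => (t, y))) // diff_comp //=.
by rewrite diff_val.
Qed.

Lemma derive1_slice :
  derive1 (v ^~ x) t = 'd (fun q : R * V => v q.1 q.2) (t, x) (1, 0).
Proof.
have df : is_diff t (fun s : R => (s, x)) (fun s => (s, 0)).
  exact: is_diff_eq.
have dvx : differentiable (v ^~ x) t.
  exact: (@differentiable_comp _ _ _ _ (fun s => (s, x)) (fun q => v q.1 q.2)).
rewrite derive1E' //.
rewrite (_ : v ^~ x = (fun q => v q.1 q.2) \o (fun s => (s, x))) //.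
by rewrite diff_comp //= diff_val.
Qed.

End Slices.

(** A solution is constant on the characteristics [s |-> (t - s, flow T s x)],
    which run from [(t, x)] to [(0, flow T t x)]. *)
Lemma constant_along_flow (R : realType) (n : nat) (T : tree_diagram n)
    (f : 'rV[R]_n.+1 -> R) (v : R -> 'rV[R]_n.+1 -> R) :
  is_solution T f v -> forall t x, v t x = f (flow T t x).
Proof.
move=> [dv pde v0] t x.
pose c (s : R) := v (t - s) (flow T s x).
suff dc0 (s : R) : is_derive s 1 c 0.
  by have := is_derive_0_is_cst 0 t dc0; rewrite /c subr0 flow0 subrr v0.
set y := flow T s x.
have dc : is_derive s 1 (fun r => (t - r, flow T r x)) (- 1, velocity T y).
  have [dF FE] := is_derive_flow T x s.
  have dF' : differentiable (flow T ^~ x) s by exact/derivable1_diffP.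
  have dt : is_derive s (1 : R) (fun r : R => t - r) (- 1).
    by apply: is_derive_eq; rewrite add0r mul1r.
  have dt' : differentiable (fun r : R => t - r) s by exact/derivable1_diffP.
  have dp : differentiable (fun r => (t - r, flow T r x)) s.
    exact: differentiable_pair.
  apply: DeriveDef; first exact/derivable1_diffP.
  by rewrite deriveE // diff_pair // -!deriveE // FE derive_val.
have := is_derive_diff_comp (dv (t - s, y)) dc.
suff <- : 'd (fun q => v q.1 q.2) (t - s, y) (- 1, velocity T y) = 0 by [].
(* Along the curve, time runs backwards at unit speed while the position moves
   with the flow; the equation says that the two contributions cancel. *)
have -> : (- 1, velocity T y) = - (1, 0) + (0, velocity T y) :> R * 'rV[R]_n.+1.
  by congr (_, _); rewrite /= ?addr0 ?oppr0 ?add0r.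
rewrite linearD linearN /= -derive1_slice // -diff_slice // pde.
rewrite diff_velocity ?addNr //; exact: differentiable_slice.
Qed.

(** The semigroup law moves the time derivative of [u] into the space variable:
    [u s x = u t (flow T (s - t) x)], and [s |-> flow T (s - t) x] passes
    through [x] at [s = t] with velocity [velocity T x]. *)
Lemma flow_is_solution (R : realType) (n : nat) (T : tree_diagram n)
    (f : 'rV[R]_n.+1 -> R) :
  (forall x, differentiable f x) -> is_solution T f (fun t x => f (flow T t x)).
Proof.
move=> df; pose u (t : R) (x : 'rV[R]_n.+1) := f (flow T t x).
suff: is_solution T f u by [].
have du (p : R * 'rV[R]_n.+1) :
    differentiable (fun q : R * 'rV[R]_n.+1 => u q.1 q.2) p.
  apply: (@differentiable_comp _ _ _ _ (fun q => flow T q.1 q.2) f) => //.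
  exact: differentiable_flow.
split=> // [t x|x]; last by rewrite /u flow0.
have du_t : differentiable (u t) x by exact: (differentiable_slice (du _)).
rewrite -diff_velocity //.
have dc : is_derive t 1 ((flow T ^~ x) \o (fun s => s - t)) (velocity T x).
  have dF := is_derive_flow T x (t - t).
  have dt : is_derive t (1 : R) (fun s : R => s - t) 1.
    exact: is_derive_shift.
  have dF' : differentiable (flow T ^~ x) (t - t) by exact/derivable1_diffP.
  have := @is_derive_diff_comp R _ _ (flow T ^~ x) (fun s => s - t) t 1 dF' dt.
  by rewrite -deriveE // derive_val subrr flow0.
have uE : u ^~ x = u t \o ((flow T ^~ x) \o (fun s => s - t)).
  by apply/funext => s; rewrite /u /= -flowD addrC subrK.
have fl0 : ((flow T ^~ x) \o (fun s => s - t)) t = x by rewrite /= subrr flow0.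
rewrite -fl0 in du_t; have := is_derive_diff_comp du_t dc.
rewrite -uE fl0 => h.
by rewrite derive1E derive_val.
Qed.

Theorem theorem4p3 (R : realType) (n : nat) (T : tree_diagram n)
    (f : 'rV[R]_n.+1 -> R)
    (f_diff : forall x : 'rV[R]_n.+1, differentiable f x) :
  let u := fun (t : R) (x : 'rV[R]_n.+1) =>
    f (\row_i (x 0 i + eta_fun T x i t)) in
  is_solution T f u /\
  (forall v : R -> 'rV[R]_n.+1 -> R, is_solution T f v ->
     forall (t : R) (x : 'rV[R]_n.+1), v t x = u t x).
Proof.
move=> u.
have -> : u = (fun t x => f (flow T t x)).
  by apply/funext => t; apply/funext => x; rewrite flow_eta.
split; first exact: flow_is_solution.
by move=> v vsol t x; exact: constant_along_flow.
Qed.
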